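(* The set $\{ \underset{\sim}{R}(T) : T \in \mathbb{C}^{d_1} \otimes \cdots \otimes \mathbb{C}^{d_k}, d \in \mathbb{Z}^k_{\geq1} \}$ is complete, i.e., closed in the Euclidean topology on $\mathbb{R}$ (every convergent sequence in it has its limit in it).
   Context: For a $k$-tensor $T$ over $\mathbb{C}$, $R(T)$ is the tensor rank (smallest number of simple tensors summing to $T$), $\boxtimes$ is the Kronecker product of $k$-tensors (tensor product with corresponding legs grouped), and the asymptotic rank is $\underset{\sim}{R}(T)=\lim_{n\to\infty}R(T^{\boxtimes n})^{1/n}$. *)

(* Defs.v *)
From mathcomp Require Import all_boot all_order all_algebra.
From mathcomp Require Import complex.
From mathcomp Require Import all_classical all_reals all_analysis.

Set Implicit Arguments.
Unset Strict Implicit.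
Unset Printing Implicit Defensive.
Import Order.TTheory GRing.Theory Num.Theory.
Import numFieldNormedType.Exports.
Local Open Scope classical_set_scope.
Local Open Scope ring_scope.

(* An element of F^(I 0) (x) ... (x) F^(I (k-1)), given by its coordinates in
   the standard basis. Legs are indexed by arbitrary finite types, so that the
   legs of a Kronecker product are indexed by pairs; F^d is the case 'I_d. *)
Definition tensor (F : fieldType) (k : nat) (I : 'I_k -> finType) : Type :=
  {ffun {dffun forall i : 'I_k, I i} -> F}.

Definition pure_tensor (F : fieldType) (k : nat) (I : 'I_k -> finType)
    (v : forall i : 'I_k, {ffun I i -> F}) : tensor F I :=
  [ffun x : {dffun forall i : 'I_k, I i} => \prod_(i < k) v i (x i)].

Definition simple_tensor (F : fieldType) (k : nat) (I : 'I_k -> finType)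
    (T : tensor F I) : Prop :=
  exists v : forall i : 'I_k, {ffun I i -> F}, T = pure_tensor v.

Definition sum_of_simple (F : fieldType) (k : nat) (I : 'I_k -> finType)
    (T : tensor F I) (r : nat) : Prop :=
  exists2 S : 'I_r -> tensor F I,
    forall j, simple_tensor (S j) & T = \sum_(j < r) S j.

(* For k > 0 the minimum exists, see tensor_rankP; the default value 0 is only
   relevant for k = 0. *)
Definition tensor_rank (F : fieldType) (k : nat) (I : 'I_k -> finType)
    (T : tensor F I) : nat :=
  xget 0%N [set r | sum_of_simple T r /\
                    forall s, sum_of_simple T s -> (r <= s)%N].

Definition kron (F : fieldType) (k : nat) (I J : 'I_k -> finType)
    (T : tensor F I) (S : tensor F J) :
    tensor F (fun i => (I i * J i)%type : finType) :=
  [ffun x : {dffun forall i : 'I_k, (I i * J i)%type} =>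
     T (finfun (fun i => (x i).1)) * S (finfun (fun i => (x i).2))].

Fixpoint kron_pow_leg (A : finType) (n : nat) : finType :=
  if n is m.+1 then (kron_pow_leg A m * A)%type : finType else unit : finType.

Fixpoint kron_pow (F : fieldType) (k : nat) (I : 'I_k -> finType)
    (T : tensor F I) (n : nat) : tensor F (fun i => kron_pow_leg (I i) n) :=
  match n return tensor F (fun i => kron_pow_leg (I i) n) with
  | 0 => [ffun=> 1]
  | m.+1 => kron (kron_pow T m) T
  end.

(* The sequence converges by submultiplicativity of the rank (Fekete), so
   [limn] is a genuine limit here. *)
Definition asymptotic_rank (R : realType) (F : fieldType) (k : nat)
    (I : 'I_k -> finType) (T : tensor F I) : R :=
  limn (fun n : nat => (tensor_rank (kron_pow T n))%:R `^ n%:R^-1 : R).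

Definition asymptotic_ranks (R : realType) (k : nat) : set R :=
  [set r | exists d : 'I_k -> nat, (forall i, (0 < d i)%N) /\
     exists T : tensor R[i] (fun i => 'I_(d i) : finType),
       r = asymptotic_rank R T].
Arguments asymptotic_ranks : clear implicits.

Lemma sum_of_simple_exists (F : fieldType) (k : nat) (I : 'I_k -> finType)
    (T : tensor F I) : (0 < k)%N -> exists r, sum_of_simple T r.
Proof.
case: k I T => // k I T _.
pose D : finType := {dffun forall i : 'I_k.+1, I i}.
pose v (x : D) (i : 'I_k.+1) : {ffun I i -> F} :=
  [ffun a => (if i == ord0 then T x else 1) * (a == x i)%:R].
exists #|D|, (fun j => pure_tensor (v (enum_val j))) => [j|].
  by exists (v (enum_val j)).
apply/ffunP => y; rewrite sum_ffunE.
rewrite -(big_enum_val (fun x : D => pure_tensor (v x) y)) /=.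
rewrite (bigD1 (y : D)) //= big1 ?addr0 => [|x xy].
  rewrite ffunE big_ord_recl ffunE !eqxx mulr1 big1 ?mulr1 // => i _.
  by rewrite ffunE eqxx mulr1.
rewrite ffunE; have [i yxi] : exists i, y i != x i.
  apply/existsP; apply: contraNT xy; rewrite negb_exists => /forallP h.
  by apply/eqP/ffunP => i; apply/esym/eqP; rewrite -[_ == _]negbK h.
by rewrite (bigD1 i) //= ffunE (negbTE yxi) mulr0 mul0r.
Qed.

Lemma tensor_rankP (F : fieldType) (k : nat) (I : 'I_k -> finType)
    (T : tensor F I) : (0 < k)%N ->
  sum_of_simple T (tensor_rank T) /\
  forall s, sum_of_simple T s -> (tensor_rank T <= s)%N.
Proof.
move=> /(sum_of_simple_exists T) [r0 hr0].
have ex : exists r, `[< sum_of_simple T r >] by exists r0; apply/asboolP.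
case: (ex_minnP ex) => m /asboolP hm mmin.
rewrite /tensor_rank; case: xgetP => [r _ //|/(_ m)[]]; split=> // s hs.
by apply: mmin; apply/asboolP.
Qed.

(* Main.v *)
(** Write [R T] for the asymptotic rank.  Two facts drive the proof.
    If [T^n] lies in the span of the powers [S^n] of tensors with [R S < s],
    then polynomially many [S] suffice, and expanding high powers of the
    resulting linear combination gives [R T ^ n <= (n+1)^D * s ^ n]; membership
    in the span is a polynomial condition on [T].
    Conversely [R T] bounds the flattening ranks of [T], so a tensor of
    asymptotic rank less than [B] may be compressed to legs of size [B], and a
    limit point [r] of the asymptotic ranks is a limit within one fixed format.
    Let [U] be an ultrafilter on that format along which [R] tends to [r].  The
    polynomials vanishing [U]-almost everywhere form a prime ideal [P].  By the
    first fact, every zero [T] of [P] has [R T <= r], and for [s < r] some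
    polynomial outside [P] vanishes on [{R < s}].  As the complex numbers are
    uncountable, some zero of [P] avoids countably many such hypersurfaces, for
    [s] increasing to [r]; it has asymptotic rank exactly [r]. *)

Require Import Defs.
From mathcomp Require Import all_boot all_order all_algebra.
From mathcomp Require Import complex.
From mathcomp Require Import all_classical all_reals all_analysis.
From mathcomp Require Import ring lra.
Import numFieldNormedType.Exports.
From mathcomp Require mpoly.
(* A plain [Import mpoly] would clash with the notations of MathComp-Analysis. *)
Import (canonicals, coercions) mpoly.

Set Implicit Arguments.
Unset Strict Implicit.
Unset Printing Implicit Defensive.
Import Order.TTheory GRing.Theory Num.Theory.
Local Open Scope classical_set_scope.
Local Open Scope ring_scope.

(** * Tensor rank *)

Lemma big_distr_dffun (R : comPzSemiRingType) (I : finType) (J : I -> finType)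
    (h : forall i, J i -> R) :
  \prod_i \sum_(a : J i) h i a =
  \sum_(y : {dffun forall i, J i}) \prod_i h i (y i).
Proof.
under eq_bigr => i _ do rewrite (@big_tag R 0 _ I J h i).
rewrite bigA_distr_big_dep.
pose H i : {ffun J i -> R} := [ffun a => h i a].
rewrite (reindex (@dffun_of_fprod I J)); last exact/onW_bij/dffun_of_fprod_bij.
transitivity (\sum_(t : fprod J) \prod_(i in I) H i (t i)); last first.
  by apply: eq_bigr => t _; apply: eq_bigr => i _; rewrite !ffunE.
rewrite (@big_fprod R 0 1 *%R +%R I J H); apply: eq_bigr => f _.
apply: eq_bigr => i _; rewrite /untag.
by case: eqP => // e; rewrite ffunE.
Qed.

Section TensorOps.
Variables (F : fieldType) (k : nat).
Implicit Types I J L : 'I_k -> finType.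

Lemma sum_of_simple_fin I (E : finType) (T : tensor F I) (S : E -> tensor F I) :
  (forall e, simple_tensor (S e)) -> T = \sum_e S e -> sum_of_simple T #|E|.
Proof.
move=> Ss ->; exists (fun j => S (enum_val j)) => //.
by rewrite -(big_enum_val (fun e => S e)).
Qed.

Definition pullback I J (h : forall i, J i -> I i) (T : tensor F I) :
    tensor F J :=
  [ffun x : {dffun forall i, J i} => T (finfun (fun i => h i (x i)))].

Definition hadamard I (T S : tensor F I) : tensor F I :=
  [ffun x => T x * S x].

Definition family_prod I (K : finType) (W : K -> tensor F I) :
    tensor F (fun i => {ffun K -> I i} : finType) :=
  [ffun f : {dffun forall i, {ffun K -> I i}} =>
     \prod_t W t (finfun (fun i => f i t))].

Definition legwise I J (G : forall i, J i -> I i -> F) (T : tensor F I) :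
    tensor F J :=
  [ffun x : {dffun forall i, J i} =>
     \sum_(y : {dffun forall i, I i}) (\prod_i G i (x i) (y i)) * T y].

Lemma simple_pullback I J (h : forall i, J i -> I i) (T : tensor F I) :
  simple_tensor T -> simple_tensor (pullback h T).
Proof.
case=> v ->; exists (fun i => [ffun a => v i (h i a)]).
by apply/ffunP => x; rewrite !ffunE; apply: eq_bigr => i _; rewrite !ffunE.
Qed.

Lemma sum_of_simple_pullback I J (h : forall i, J i -> I i) (T : tensor F I) r :
  sum_of_simple T r -> sum_of_simple (pullback h T) r.
Proof.
case=> S Ss ->; exists (fun j => pullback h (S j)).
  by move=> j; apply: simple_pullback.
apply/ffunP => x; rewrite sum_ffunE ffunE sum_ffunE.
by apply: eq_bigr => j _; rewrite !ffunE.
Qed.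

Lemma simple_legwise I J (G : forall i, J i -> I i -> F) (T : tensor F I) :
  simple_tensor T -> simple_tensor (legwise G T).
Proof.
case=> v ->; exists (fun i => [ffun x => \sum_a G i x a * v i a]).
apply/ffunP => x; rewrite !ffunE.
under [RHS]eq_bigr do rewrite ffunE.
rewrite big_distr_dffun; apply: eq_bigr => y _.
by rewrite ffunE big_split.
Qed.

Lemma sum_of_simple_legwise I J (G : forall i, J i -> I i -> F)
    (T : tensor F I) r :
  sum_of_simple T r -> sum_of_simple (legwise G T) r.
Proof.
case=> S Ss ->; exists (fun j => legwise G (S j)).
  by move=> j; apply: simple_legwise.
apply/ffunP => x; rewrite sum_ffunE ffunE.
under [RHS]eq_bigr do rewrite ffunE.
rewrite exchange_big; apply: eq_bigr => y _.
by rewrite sum_ffunE mulr_sumr.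
Qed.

Lemma sum_of_simple_hadamard I (T S : tensor F I) r s :
  sum_of_simple T r -> sum_of_simple S s ->
  sum_of_simple (hadamard T S) (r * s)%N.
Proof.
move=> [A As ->] [B Bs ->].
have -> : (r * s)%N = #|{: 'I_r * 'I_s}| by rewrite card_prod !card_ord.
apply: (@sum_of_simple_fin _ _ _ (fun p => hadamard (A p.1) (B p.2))).
  move=> [i j] /=; have [v ->] := As i; have [w ->] := Bs j.
  exists (fun i => [ffun a => v i a * w i a]); apply/ffunP => x.
  by rewrite !ffunE -big_split; apply: eq_bigr => l _; rewrite !ffunE.
rewrite -(pair_bigA _ (fun i j => hadamard (A i) (B j))) /=.
apply/ffunP => x; rewrite ffunE !sum_ffunE mulr_suml; apply: eq_bigr => i _.
by rewrite sum_ffunE mulr_sumr; apply: eq_bigr => j _; rewrite ffunE.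
Qed.

Lemma sum_of_simple_prod I (E : finType) (U : E -> tensor F I) (r : E -> nat) :
  (forall e, sum_of_simple (U e) (r e)) ->
  sum_of_simple ([ffun x => \prod_e U e x] : tensor F I) (\prod_e r e)%N.
Proof.
move=> Us; pose Q (T : tensor F I) n := sum_of_simple T n.
suff: forall s : seq E, Q [ffun x => \prod_(e <- s) U e x] (\prod_(e <- s) r e)%N.
  exact.
elim=> [|e s IH]; rewrite /Q.
  exists (fun=> [ffun=> 1]) => [_|].
    exists (fun i => [ffun=> 1]); apply/ffunP => x; rewrite !ffunE.
    by rewrite big1 // => i _; rewrite ffunE.
  apply/ffunP=> x; rewrite sum_ffunE !big_nil ffunE big_nil.
  by rewrite big_ord_recl big_ord0 addr0 ffunE.
rewrite big_cons.
have -> : ([ffun x => \prod_(e0 <- e :: s) U e0 x] : tensor F I) =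
    hadamard (U e) [ffun x => \prod_(e0 <- s) U e0 x].
  by apply/ffunP=> x; rewrite !ffunE big_cons.
exact: sum_of_simple_hadamard.
Qed.

Lemma sum_of_simpleD I (T S : tensor F I) r s :
  sum_of_simple T r -> sum_of_simple S s -> sum_of_simple (T + S) (r + s)%N.
Proof.
move=> [A As ->] [B Bs ->].
exists (fun j => match fintype.split j with inl i => A i | inr i => B i end).
  by move=> j; case: fintype.split.
rewrite big_split_ord /=; congr (_ + _); apply: eq_bigr => i _.
  by have := unsplitK (inl i : 'I_r + 'I_s) => /= ->.
by have := unsplitK (inr i : 'I_r + 'I_s) => /= ->.
Qed.

Lemma sum_of_simple_sum I (E : finType) (U : E -> tensor F I) (r : E -> nat) :
  (forall e, sum_of_simple (U e) (r e)) ->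
  sum_of_simple (\sum_e U e) (\sum_e r e)%N.
Proof.
move=> Us; apply: (big_rec2 (fun T n => sum_of_simple T n)).
  by exists (fun=> 0); [case | rewrite big_ord0].
by move=> e n T _; apply: sum_of_simpleD.
Qed.

Lemma sum_of_simpleZ I (T : tensor F I) c r : (0 < k)%N ->
  sum_of_simple T r -> sum_of_simple ([ffun x => c * T x] : tensor F I) r.
Proof.
case: k I T => // k' I T _ [S Ss ->].
exists (fun j => [ffun x => c * S j x]).
  move=> j; have [v ->] := Ss j.
  exists (fun i => [ffun a => (if i == ord0 then c else 1) * v i a]).
  apply/ffunP => x; rewrite !ffunE.
  under [RHS]eq_bigr do rewrite ffunE.
  by rewrite big_split /= -big_mkcond big_pred1_eq.
apply/ffunP => x; rewrite ffunE !sum_ffunE mulr_sumr.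
by apply: eq_bigr => j _; rewrite ffunE.
Qed.

Lemma tensor_rank_le I (T : tensor F I) r : (0 < k)%N ->
  sum_of_simple T r -> (tensor_rank T <= r)%N.
Proof. by move=> hk; apply: (tensor_rankP T hk).2. Qed.

Lemma tensor_rank_sum I (T : tensor F I) : (0 < k)%N ->
  sum_of_simple T (tensor_rank T).
Proof. by move=> hk; apply: (tensor_rankP T hk).1. Qed.

End TensorOps.

(** * Kronecker powers *)

Section KronPower.
Variables (F : fieldType) (k : nat) (hk : (0 < k)%N).
Implicit Types I J : 'I_k -> finType.

Fixpoint pow_coord (A : finType) (n : nat) : kron_pow_leg A n -> {ffun 'I_n -> A} :=
  match n return kron_pow_leg A n -> {ffun 'I_n -> A} with
  | 0 => fun _ => ffun0 (card_ord 0)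
  | m.+1 => fun p =>
      [ffun t => if unlift ord_max t is Some t' then pow_coord p.1 t' else p.2]
  end.

Fixpoint pow_of_coord (A : finType) (n : nat) : {ffun 'I_n -> A} -> kron_pow_leg A n :=
  match n return {ffun 'I_n -> A} -> kron_pow_leg A n with
  | 0 => fun _ => tt
  | m.+1 => fun f =>
      (pow_of_coord [ffun t => f (lift ord_max t)], f ord_max)
  end.

Lemma pow_of_coordK (A : finType) n : cancel (@pow_of_coord A n) (@pow_coord A n).
Proof.
elim: n => [|n IH] f; apply/ffunP => t; first by case: t.
by rewrite /= ffunE; case: unliftP => [t' ->|->] //=; rewrite IH ffunE.
Qed.

Lemma kron_powE I (T : tensor F I) n (x : {dffun forall i, kron_pow_leg (I i) n}) :
  kron_pow T n x = \prod_(t < n) T (finfun (fun i => pow_coord (x i) t)).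
Proof.
elim: n x => [|n IH] x /=; first by rewrite ffunE big_ord0.
rewrite ffunE IH big_ord_recr /=; congr (_ * T _).
  apply: eq_bigr => t _; congr (T _); apply/ffunP => i; rewrite !ffunE.
  have -> : widen_ord (leqnSn n) t = lift ord_max t.
    by apply/val_inj; rewrite /= /bump leqNgt ltn_ord.
  by rewrite liftK.
by apply/ffunP => i; rewrite !ffunE unlift_none.
Qed.

Lemma tensor_rank_pullback_le I J (h : forall i, J i -> I i) (T : tensor F I) :
  (tensor_rank (pullback h T) <= tensor_rank T)%N.
Proof.
apply: (tensor_rank_le hk); apply: sum_of_simple_pullback.
exact: tensor_rank_sum.
Qed.

Definition prank I (T : tensor F I) n := tensor_rank (kron_pow T n).

Lemma prankE I (T : tensor F I) (K : finType) :
  prank T #|K| = tensor_rank (family_prod (fun _ : K => T)).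
Proof.
rewrite /prank; apply/eqP; rewrite eqn_leq; apply/andP; split.
  pose h i (p : kron_pow_leg (I i) #|K|) : {ffun K -> I i} :=
    [ffun t => pow_coord p (enum_rank t)].
  suff -> : kron_pow T #|K| = pullback h (family_prod (fun _ : K => T)).
    exact: tensor_rank_pullback_le.
  apply/ffunP => x; rewrite kron_powE !ffunE.
  rewrite (reindex (@enum_rank K)) /=; last exact/onW_bij/enum_rank_bij.
  apply: eq_bigr => t _.
  by congr (T _); apply/ffunP => i; rewrite !ffunE.
pose h i (f : {ffun K -> I i}) : kron_pow_leg (I i) #|K| :=
  pow_of_coord [ffun t => f (enum_val t)].
suff -> : family_prod (fun _ : K => T) = pullback h (kron_pow T #|K|).
  exact: tensor_rank_pullback_le.
apply/ffunP => x; rewrite !ffunE kron_powE.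
rewrite (reindex (@enum_val K predT)) /=; last exact/onW_bij/enum_val_bij.
  apply: eq_bigr => t _.
by congr (T _); apply/ffunP => i; rewrite !ffunE pow_of_coordK ffunE.
Qed.

Lemma sum_of_simple_colour I (K E : finType) (c : K -> E) (S : E -> tensor F I) :
  sum_of_simple (family_prod (fun t => S (c t)))
    (\prod_e prank (S e) #|[pred t | c t == e]|)%N.
Proof.
pose K' e : finType := {t in [pred t | c t == e]}.
pose h e i (f : {ffun K -> I i}) : {ffun K' e -> I i} := [ffun t => f (val t)].
pose U e := pullback (h e) (family_prod (fun _ : K' e => S e)).
have -> : family_prod (fun t => S (c t)) = [ffun x => \prod_e U e x].
  apply/ffunP => x; rewrite !ffunE (partition_big c xpredT) //=.
  apply: eq_bigr => e _; rewrite !ffunE.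
  rewrite [LHS](big_sub [pred t | c t == e]); apply: eq_bigr => t _.
  have /eqP -> : c (val t) == e := valP t.
  by congr (S _ _); apply/ffunP => i; rewrite !ffunE.
apply: sum_of_simple_prod => e.
have -> : #|[pred t | c t == e]| = #|K' e| by rewrite card_sig.
rewrite prankE; apply: sum_of_simple_pullback; exact: tensor_rank_sum.
Qed.

Lemma prankD I (T : tensor F I) m n : (prank T (m + n) <= prank T m * prank T n)%N.
Proof.
pose c (t : 'I_m + 'I_n) := if t is inl _ then true else false.
have := sum_of_simple_colour c (fun=> T); rewrite big_bool /=.
have -> : #|[pred t | c t == true]| = m.
  rewrite -[RHS]card_ord -[RHS](fintype.card_image (inl_inj : injective (@inl 'I_m 'I_n))).
  apply: eq_card => -[t|t]; rewrite !inE /=; first by rewrite fintype.image_f.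
  by apply/esym/negbTE/fintype.imageP => -[].
have -> : #|[pred t | c t == false]| = n.
  rewrite -[RHS]card_ord -[RHS](fintype.card_image (inr_inj : injective (@inr 'I_m 'I_n))).
  apply: eq_card => -[t|t]; rewrite !inE /=; last by rewrite fintype.image_f.
  by apply/esym/negbTE/fintype.imageP => -[].
move/(tensor_rank_le hk); rewrite -prankE card_sum !card_ord.
by [].
Qed.

Lemma prank_legwise I J (G : forall i, J i -> I i -> F) (T : tensor F I) n :
  (prank (legwise G T) n <= prank T n)%N.
Proof.
have -> : n = #|'I_n| by rewrite card_ord.
rewrite !prankE.
pose K := 'I_n.
pose Gn i (f : {ffun K -> J i}) (g : {ffun K -> I i}) := \prod_t G i (f t) (g t).
suff -> : family_prod (fun _ : K => legwise G T) =
          legwise Gn (family_prod (fun _ : K => T)).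
  apply: (tensor_rank_le hk); apply: sum_of_simple_legwise.
  exact: tensor_rank_sum.
apply/ffunP => f; rewrite !ffunE.
under eq_bigr do rewrite ffunE.
rewrite bigA_distr_bigA /=.
pose D : finType := {dffun forall i, I i}.
pose Y (g : {dffun forall i, {ffun K -> I i}}) : {ffun K -> D} :=
  [ffun t => finfun (fun i => g i t)].
rewrite (reindex Y); last first.
  exists (fun y : {ffun K -> D} => finfun (fun i => [ffun t => y t i])) => [g _|y _].
    by apply/ffunP => i; apply/ffunP => t; rewrite !ffunE.
  by apply/ffunP => t; apply/ffunP => i; rewrite !ffunE.
apply: eq_bigr => g _; rewrite ffunE big_split /=; congr (_ * _); last first.
  by apply: eq_bigr => t _; rewrite ffunE.
rewrite exchange_big /=; apply: eq_bigr => i _; apply: eq_bigr => t _.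
by rewrite !ffunE.
Qed.

End KronPower.

(** * Fekete's lemma for roots *)

Section Growth.
Variable R : realType.

Lemma bernoulli_ineq (h : R) n : 0 <= h -> 1 + n%:R * h <= (1 + h) ^+ n.
Proof.
move=> h0; elim: n => [|n IH]; first by rewrite mul0r addr0 expr0.
rewrite exprS; apply: (le_trans _ (ler_wpM2l _ IH)); last by rewrite addr_ge0.
have : 0 <= n%:R * h * h by rewrite !mulr_ge0.
by rewrite -natr1; lra.
Qed.

Lemma near_cst_le_expr (C q : R) : 1 < q -> \forall n \near \oo, C <= q ^+ n.
Proof.
move=> q1; near=> n.
have h0 : 0 < q - 1 by rewrite subr_gt0.
have := bernoulli_ineq n (ltW h0); rewrite [1 + (_ - 1)]addrC subrK; apply: le_trans.
have : C / (q - 1) <= n%:R by near: n; exact: nbhs_infty_ger.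
by rewrite ler_pdivrMr //; lra.
Unshelve. all: by end_near. Qed.

Lemma near_poly_le_expr (D : nat) (C q : R) : 1 < q ->
  \forall n \near \oo, C * n.+1%:R ^+ D <= q ^+ n.
Proof.
have sq1 (p : R) : 1 < p -> 1 < Num.sqrt p.
  by move=> p1; rewrite -[ltLHS]sqrtr1 ltr_sqrt// (lt_trans _ p1).
have sqE (p : R) n : 1 < p -> p ^+ n = Num.sqrt p ^+ n * Num.sqrt p ^+ n.
  move=> p1; rewrite -exprMn -expr2 sqr_sqrtr//.
  by rewrite (le_trans _ (ltW p1)).
elim: D C q => [|D IH] C q q1.
  near=> n; rewrite expr0 mulr1.
  by near: n; apply: near_cst_le_expr.
have lin (p : R) : 1 < p -> \forall n \near \oo, n.+1%:R <= p ^+ n.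
  move=> p1; near=> n.
  have h0 : 0 < Num.sqrt p - 1 by rewrite subr_gt0 sq1.
  have := bernoulli_ineq n (ltW h0); rewrite [1 + (_ - 1)]addrC subrK => b.
  have h1 : (Num.sqrt p - 1)^-1 <= Num.sqrt p ^+ n.
    by near: n; apply: near_cst_le_expr; apply: sq1.
  have h2 : 1 <= Num.sqrt p ^+ n by apply: exprn_ege1; rewrite ltW // sq1.
  have h3 : 1 <= Num.sqrt p ^+ n * (Num.sqrt p - 1).
    by rewrite -ler_pdivrMr // div1r.
  rewrite (sqE p n p1) -natr1.
  suff : n%:R <= Num.sqrt p ^+ n * (Num.sqrt p ^+ n - 1) by lra.
  apply: le_trans (_ : Num.sqrt p ^+ n * (n%:R * (Num.sqrt p - 1)) <= _).
    rewrite mulrCA; apply: ler_peMr => //.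
  by apply: ler_wpM2l; lra.
near=> n.
rewrite exprSr mulrA (sqE q n q1).
apply: le_trans (_ : Num.sqrt q ^+ n * n.+1%:R <= _).
  apply: ler_wpM2r => //.
  by near: n; apply: IH; apply: sq1.
apply: ler_wpM2l; first by rewrite exprn_ge0 // sqrtr_ge0.
by near: n; apply: lin; apply: sq1.
Unshelve. all: by end_near. Qed.

Section Fekete.
Variable a : nat -> nat.
Hypothesis aD : forall m n, (a (m + n) <= a m * a n)%N.

Let u (n : nat) : R := (a n)%:R `^ n%:R^-1.
Let L : R := inf [set u n | n in [set n | (0 < n)%N]].

Let u_ge0 n : 0 <= u n. Proof. exact: powR_ge0. Qed.

Let u_expr n : (0 < n)%N -> u n ^+ n = (a n)%:R.
Proof.
move=> n0; rewrite -powR_mulrn // /u -powRrM mulVf ?powRr1 //.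
by rewrite pnatr_eq0 -lt0n.
Qed.

Let u_inf : has_inf [set u n | n in [set n | (0 < n)%N]].
Proof. by split; [exists (u 1), 1%N | exists 0 => _ [n _ <-]]. Qed.

Let L_ge0 : 0 <= L.
Proof. by apply: lb_le_inf => [|_ [n _ <-]]; [case: u_inf|]. Qed.

Let L_le n : (0 < n)%N -> L <= u n.
Proof. by move=> n0; apply: inf_lbound; [case: u_inf | exists n]. Qed.

Let a_mul n q s : (a (q * n + s) <= a n ^ q * a s)%N.
Proof.
elim: q => [|q IH]; first by rewrite mul0n add0n expn0 mul1n.
rewrite mulSn -addnA expnS -mulnA; apply: (leq_trans (aD _ _)).
by rewrite leq_mul2l IH orbT.
Qed.

Let a_bound s : L < s -> exists2 C, 0 < C & forall N, (a N)%:R <= C * s ^+ N.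
Proof.
move=> Ls; have s0 := le_lt_trans L_ge0 Ls.
have [_ [n n0 <-] uns] := inf_lt u_inf.1 Ls.
have ans : (a n)%:R <= s ^+ n.
  by rewrite -u_expr //; apply: lerXn2r; rewrite ?nnegrE // ltW.
exists (1 + \sum_(t < n) (a t)%:R / s ^+ t).
  by rewrite ltr_wpDr // sumr_ge0 // => t _; rewrite divr_ge0 // exprn_ge0 // ltW.
move=> N; rewrite (divn_eq N n).
set q := (N %/ n)%N; set t := (N %% n)%N.
have tn : (t < n)%N by rewrite ltn_mod.
apply: le_trans (_ : (a n ^ q * a t)%:R <= _); first by rewrite ler_nat a_mul.
rewrite natrM natrX exprD mulnC exprM mulrCA.
apply: ler_pM; rewrite ?exprn_ge0 //.
  by apply: lerXn2r; rewrite ?nnegrE // exprn_ge0 // ltW.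
rewrite -ler_pdivrMr ?exprn_gt0 //.
rewrite (bigD1 (Ordinal tn)) //= addrCA ler_wpDr //.
rewrite addr_ge0 // sumr_ge0 // => i _.
by rewrite divr_ge0 // exprn_ge0 // ltW.
Qed.

Let u_cvg : u n @[n --> \oo] --> L.
Proof.
apply/cvgrPdist_le => e e0.
have e2 : 0 < e / 2 by rewrite divr_gt0.
have Ls : L < L + e / 2 by rewrite ltrDl.
have [C C0 aC] := a_bound Ls.
have s0 := le_lt_trans L_ge0 Ls.
near=> n.
have n0 : (0 < n)%N by near: n; exists 1%N.
rewrite distrC ger0_norm ?subr_ge0 ?L_le // lerBlDl.
have Le0 : 0 <= L + e by rewrite addr_ge0 // ltW.
rewrite -(@ler_pXn2r _ n) ?nnegrE // u_expr //.
apply: (le_trans (aC n)).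
rewrite -ler_pdivlMr ?exprn_gt0 // -expr_div_n.
near: n; apply: near_cst_le_expr.
by rewrite ltr_pdivlMr // mul1r ltrD2l ltr_pdivrMr // mulr_natr mulr2n ltrDl.
Unshelve. all: by end_near. Qed.

Lemma fekete_root :
  [/\ 0 <= limn u, forall n, (0 < n)%N -> limn u ^+ n <= (a n)%:R &
      forall s, limn u < s ->
        exists2 C, 0 < C & forall N, (a N)%:R <= C * s ^+ N].
Proof.
have -> : limn u = L by apply: cvg_lim.
split=> // n n0; rewrite -u_expr //.
by apply: lerXn2r; rewrite ?nnegrE // L_le.
Qed.

End Fekete.

Lemma le_expr_growth (x y C : R) :
  0 <= y -> (forall N, (0 < N)%N -> x ^+ N <= C * y ^+ N) -> x <= y.
Proof.
rewrite le_eqVlt => /predU1P[<- /(_ 1%N isT)|y0 xy].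
  by rewrite !expr1 mulr0.
rewrite leNgt; apply/negP => yx.
have q1 : 1 < x / y by rewrite ltr_pdivlMr // mul1r.
near \oo => N.
have N0 : (0 < N)%N by near: N; exists 1%N.
have : C + 1 <= (x / y) ^+ N by near: N; apply: near_cst_le_expr.
rewrite expr_div_n ler_pdivlMr ?exprn_gt0 // => /le_trans/(_ (xy N N0)).
by rewrite ler_pM2r ?exprn_gt0 // gerDl ler10.
Unshelve. all: by end_near. Qed.

End Growth.

(** * Asymptotic rank *)

Section AsymptoticRank.
Variables (R : realType) (F : fieldType) (k : nat) (hk : (0 < k)%N).
Implicit Types I J : 'I_k -> finType.

Lemma asymptotic_rank_ge0 I (T : tensor F I) : 0 <= asymptotic_rank R T.
Proof. by have [] := fekete_root R (prankD hk T). Qed.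

Lemma asymptotic_rank_expr_le I (T : tensor F I) n : (0 < n)%N ->
  asymptotic_rank R T ^+ n <= (prank T n)%:R.
Proof. by have [_ h _] := fekete_root R (prankD hk T); apply: h. Qed.

Lemma prank_growth I (T : tensor F I) s : asymptotic_rank R T < s ->
  exists2 C, 0 < C & forall N, (prank T N)%:R <= C * s ^+ N.
Proof. by have [_ _ h] := fekete_root R (prankD hk T); apply: h. Qed.

Lemma eq_asymptotic_rank I J (T : tensor F I) (S : tensor F J) :
  (forall n, prank T n = prank S n) -> asymptotic_rank R T = asymptotic_rank R S.
Proof.
by move=> TS; congr (limn _); apply/funext => n; congr (_%:R `^ _); apply: TS.
Qed.

(* Expanding [T^(nN) = (\sum_e c_e S_e^n)^N] gives [#|E| ^ N] products of
   powers of the [S_e], each of rank [O(s^(nN))]. *)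
Lemma asymptotic_rank_comb I (T : tensor F I) n (E : finType) (c : E -> F)
    (S : E -> tensor F I) (s : R) : (0 < n)%N -> 0 < s ->
  (forall e, asymptotic_rank R (S e) < s) ->
  (forall f, family_prod (fun _ : 'I_n => T) f =
     \sum_e c e * family_prod (fun _ : 'I_n => S e) f) ->
  asymptotic_rank R T ^+ n <= #|E|%:R * s ^+ n.
Proof.
move=> n0 s0 Ss TS.
have /boolp.choice[C hC] : forall e, exists C : R, 0 < C /\
    forall N, (prank (S e) N)%:R <= C * s ^+ N.
  by move=> e; have [C] := prank_growth (Ss e); exists C.
apply: (@le_expr_growth _ _ _ (\prod_e C e)) => [|N N0].
  by rewrite mulr_ge0 // exprn_ge0 // ltW.
rewrite -exprM; apply: (le_trans (asymptotic_rank_expr_le T _)).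
  by rewrite muln_gt0 n0.
pose K : finType := ('I_N * 'I_n)%type.
have -> : (n * N)%N = #|K| by rewrite card_prod !card_ord mulnC.
rewrite (prankE hk).
pose r (w : {ffun 'I_N -> E}) :=
  (\prod_e prank (S e) #|[pred p : K | w p.1 == e]|)%N.
have TK : sum_of_simple (family_prod (fun _ : K => T)) (\sum_w r w)%N.
  have -> : family_prod (fun _ : K => T) =
      \sum_(w : {ffun 'I_N -> E})
        [ffun x => (\prod_u c (w u)) * family_prod (fun p : K => S (w p.1)) x].
    apply/ffunP => x; rewrite sum_ffunE ffunE.
    transitivity (\prod_(u < N) \prod_(t < n) T (finfun (fun i => x i (u, t)))).
      by rewrite pair_bigA; apply: eq_bigr => -[].
    pose y u : {dffun forall i, {ffun 'I_n -> I i}} :=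
      finfun (fun i => [ffun t => x i (u, t)]).
    transitivity (\prod_(u < N) family_prod (fun _ : 'I_n => T) (y u)).
      apply: eq_bigr => u _; rewrite ffunE; apply: eq_bigr => t _.
      by congr (T _); apply/ffunP => i; rewrite !ffunE.
    under eq_bigr do rewrite TS.
    rewrite bigA_distr_bigA /=; apply: eq_bigr => w _.
    rewrite big_split /= !ffunE; congr (_ * _).
    transitivity (\prod_(u < N) \prod_(t < n) S (w u) (finfun (fun i => x i (u, t)))).
      apply: eq_bigr => u _; rewrite ffunE; apply: eq_bigr => t _.
      by congr (S _ _); apply/ffunP => i; rewrite !ffunE.
    by rewrite pair_bigA; apply: eq_bigr => -[].
  apply: sum_of_simple_sum => w; apply: (sum_of_simpleZ _ hk).
  exact: (sum_of_simple_colour hk (fun p : K => w p.1)).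
apply: (@le_trans _ _ (\sum_w r w)%:R).
  by rewrite ler_nat; apply: (tensor_rank_le hk).
rewrite natr_sum.
apply: (@le_trans _ _ (\sum_(w : {ffun 'I_N -> E}) (\prod_e C e) * s ^+ #|K|)).
  apply: ler_sum => w _; rewrite natr_prod.
  have -> : #|K| = (\sum_e #|[pred p : K | w p.1 == e]|)%N.
    rewrite -sum1_card (partition_big (fun p : K => w p.1) xpredT) //=.
    by apply: eq_bigr => e _; rewrite sum1_card.
  rewrite -prodrXr -big_split /=; apply: ler_prod => e _.
  by rewrite ler0n (hC e).2.
rewrite sumr_const card_ffun card_ord card_prod !card_ord.
by rewrite -[leLHS]mulr_natl natrX exprMn -exprM mulnC [(n * N)%N]mulnC mulrCA.
Qed.

End AsymptoticRank.

(** * Flattenings and compression of legs *)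

Section Compression.
Variables (F : fieldType) (k : nat).
Implicit Types I J L : 'I_k -> finType.

Definition set_leg I (y : {dffun forall i, I i}) (i0 : 'I_k) (a : I i0) :
    {dffun forall i, I i} :=
  finfun (eqtype.dfwith y a).

Lemma set_legE I (y : {dffun forall i, I i}) i0 (a : I i0) : set_leg y a i0 = a.
Proof. by rewrite ffunE dfwith_in. Qed.

Lemma set_leg_neq I (y : {dffun forall i, I i}) i0 (a : I i0) i :
  i0 != i -> set_leg y a i = y i.
Proof. by move=> ii0; rewrite ffunE dfwith_out. Qed.

Lemma flattening_le I (T : tensor F I) i0 (E : finType) (A : E -> I i0 -> F)
    (B : {dffun forall i, I i} -> E -> F) r :
  (forall e e', \sum_a \sum_y A e a * T (set_leg y a) * B y e' = (e == e')%:R) ->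
  sum_of_simple T r -> (#|E| <= r)%N.
Proof.
move=> AB [S /boolp.choice[v Sv] TS].
pose P := \matrix_(e < #|E|, j < r) \sum_a A (enum_val e) a * v j i0 a.
pose Q := \matrix_(j < r, e < #|E|)
  \sum_(y : {dffun forall i, I i}) (\prod_(i | i != i0) v j i (y i)) * B y (enum_val e).
apply: (@mulmx1_min _ _ _ P Q); apply/matrixP => e e'; rewrite !mxE.
rewrite -(inj_eq enum_val_inj) -AB.
pose w j (y : {dffun forall i, I i}) := \prod_(i | i != i0) v j i (y i).
have TE y a : T (set_leg y a) = \sum_j v j i0 a * w j y.
  rewrite TS sum_ffunE; apply: eq_bigr => j _.
  rewrite Sv ffunE (bigD1 i0) //= set_legE; congr (_ * _).
  by apply: eq_bigr => i ii0; rewrite set_leg_neq // eq_sym.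
transitivity (\sum_a \sum_(y : {dffun forall i, I i}) \sum_j
    A (enum_val e) a * (v j i0 a * w j y) * B y (enum_val e')); last first.
  by apply: eq_bigr => a _; apply: eq_bigr => y _; rewrite TE mulr_sumr mulr_suml.
under [RHS]eq_bigr do rewrite exchange_big /=.
rewrite [RHS]exchange_big /=.
apply: eq_bigr => j _; rewrite !mxE mulr_suml.
apply: eq_bigr => a _; rewrite mulr_sumr; apply: eq_bigr => y _.
by rewrite -!mulrA.
Qed.

Lemma sum_transpose I (K : finType) (V : nmodType)
    (f : {ffun K -> {dffun forall i, I i}} -> V) :
  \sum_(y : {dffun forall i, {ffun K -> I i}})
     f [ffun t => finfun (fun i => y i t)] =
  \sum_(y : {ffun K -> {dffun forall i, I i}}) f y.
Proof.
pose D : finType := {dffun forall i, I i}.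
rewrite [RHS](reindex (fun y : {dffun forall i, {ffun K -> I i}} =>
  [ffun t => finfun (fun i => y i t)] : {ffun K -> D})) //.
exists (fun y : {ffun K -> D} => finfun (fun i => [ffun t => y t i])) => [g _|y _].
  by apply/ffunP => i; apply/ffunP => t; rewrite !ffunE.
by apply/ffunP => t; apply/ffunP => i; rewrite !ffunE.
Qed.

Lemma flattening_pow_le I (hk : (0 < k)%N) (T : tensor F I) i0 (E : finType)
    (A : E -> I i0 -> F) (B : {dffun forall i, I i} -> E -> F) n :
  (forall e e', \sum_a \sum_y A e a * T (set_leg y a) * B y e' = (e == e')%:R) ->
  (#|E| ^ n <= prank T n)%N.
Proof.
move=> AB; rewrite -[n]card_ord prankE // -card_ffun.
pose K := 'I_n.
pose A' (e : {ffun K -> E}) (a : {ffun K -> I i0}) := \prod_t A (e t) (a t).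
pose B' (y : {dffun forall i, {ffun K -> I i}}) (e : {ffun K -> E}) :=
  \prod_t B (finfun (fun i => y i t)) (e t).
apply: (@flattening_le _ _ i0 _ A' B'); last exact: tensor_rank_sum.
move=> e e'.
transitivity (\sum_(a : {ffun K -> I i0}) \prod_t
    \sum_y A (e t) (a t) * T (set_leg y (a t)) * B y (e' t)).
  apply: eq_bigr => a _; rewrite bigA_distr_bigA -sum_transpose.
  apply: eq_bigr => y _; rewrite ffunE -!big_split; apply: eq_bigr => t _ /=.
  rewrite ffunE; congr (_ * T _ * _); apply/ffunP => i; rewrite ffunE.
  have [<-|ii0] := eqVneq i0 i; first by rewrite !set_legE.
  by rewrite !set_leg_neq // ffunE.
rewrite -(bigA_distr_bigA (fun t a =>
  \sum_y A (e t) a * T (set_leg y a) * B y (e' t))).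
under eq_bigr do rewrite AB.
have [->|/eqP ee'] := eqVneq e e'; first by rewrite big1 // => t _; rewrite eqxx.
have [t /negbTE et] : exists t, e t != e' t.
  apply/existsP; apply: contra_notT ee'; rewrite negb_exists => /forallP h.
  by apply/ffunP => t; apply/eqP; rewrite -[_ == _]negbK.
by rewrite (bigD1 t) //= et mul0r.
Qed.

Lemma legwise_comp I J L (G : forall i, J i -> I i -> F)
    (H : forall i, L i -> J i -> F) (T : tensor F I) :
  legwise H (legwise G T) =
  legwise (fun i c a => \sum_b H i c b * G i b a) T.
Proof.
apply/ffunP => x; rewrite !ffunE.
under eq_bigr do rewrite ffunE mulr_sumr.
rewrite exchange_big /=; apply: eq_bigr => y _.
rewrite big_distr_dffun mulr_suml; apply: eq_bigr => z _.
by rewrite mulrA -big_split.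
Qed.

Lemma legwise_id I (T : tensor F I) :
  legwise (fun i (a b : I i) => (a == b)%:R) T = T.
Proof.
apply/ffunP => x; rewrite ffunE (bigD1 x) //=.
rewrite big1 ?mul1r => [|i _]; last by rewrite eqxx.
rewrite big1 ?addr0 // => y yx.
have [i xyi] : exists i, x i != y i.
  apply/existsP; apply: contraNT yx; rewrite negb_exists => /forallP h.
  by apply/eqP/ffunP => i; apply/esym/eqP; rewrite -[_ == _]negbK h.
by rewrite (bigD1 i) //= (negbTE xyi) !mul0r.
Qed.

Lemma legwise_one_leg I (P : forall i, I i -> I i -> F) (T : tensor F I) i0 :
  (forall y a, \sum_b P i0 a b * T (set_leg y b) = T (set_leg y a)) ->
  legwise (fun i a b => if i == i0 then P i a b else (a == b)%:R) T = T.
Proof.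
move=> PT; apply/ffunP => x; rewrite ffunE.
have xE : x = set_leg x (x i0).
  apply/ffunP => i; have [<-|h] := eqVneq i0 i; first by rewrite set_legE.
  by rewrite set_leg_neq.
rewrite [in RHS]xE -PT.
rewrite (bigID (fun y : {dffun forall i, I i} => set_leg x (y i0) == y)) /=.
rewrite [X in _ + X]big1 ?addr0 => [|y]; last first.
  move=> xy; have [i xyi] : exists i, set_leg x (y i0) i != y i.
    apply/existsP; apply: contraNT xy; rewrite negb_exists => /forallP h.
    by apply/eqP/ffunP => i; apply/eqP; rewrite -[_ == _]negbK h.
  have [e|h] := eqVneq i0 i; first by move: xyi; rewrite -e set_legE eqxx.
  rewrite set_leg_neq // in xyi.
  by rewrite (bigD1 i) //= eq_sym (negbTE h) (negbTE xyi) !mul0r.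
rewrite (reindex_onto (fun a => set_leg x a) (fun y => y i0)) /=; last first.
  by move=> y /eqP.
apply: eq_big => [a|a _]; first by rewrite set_legE !eqxx.
rewrite (bigD1 i0) //= eqxx set_legE big1 ?mulr1 // => i ii0.
by rewrite (negbTE ii0) set_leg_neq ?eqxx // eq_sym.
Qed.

Lemma legwise_all_legs I (P : forall i, I i -> I i -> F) (T : tensor F I) :
  (forall i0 y a, \sum_b P i0 a b * T (set_leg y b) = T (set_leg y a)) ->
  legwise P T = T.
Proof.
move=> PT.
suff h : forall s : seq 'I_k, uniq s ->
    legwise (fun i a b => if i \in s then P i a b else (a == b)%:R) T = T.
  rewrite -[RHS](h (enum 'I_k)) ?enum_uniq //; congr legwise.
  apply: functional_extensionality_dep => i; apply/funext => a; apply/funext => b.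
  by rewrite mem_enum.
elim=> [|i0 s IH] /=; first by rewrite legwise_id.
case/andP=> i0s /IH {2}<-; rewrite -{2}(legwise_one_leg (PT i0)) legwise_comp.
congr legwise.
apply: functional_extensionality_dep => i; apply/funext => a; apply/funext => b.
rewrite inE; have [ii0|ii0] := eqVneq i i0 => /=.
  have -> : (i \in s) = false by rewrite ii0; apply/negbTE.
  rewrite (bigD1 a) //= eqxx mul1r big1 ?addr0 // => c ca.
  by rewrite eq_sym (negbTE ca) mul0r.
case: ifP => _; rewrite (bigD1 b) //= eqxx mulr1 big1 ?addr0 // => c /negbTE cb.
  by rewrite cb mulr0.
by rewrite cb mulr0.
Qed.

End Compression.

Section CompressionRank.
Variables (R : realType) (F : fieldType) (k : nat) (hk : (0 < k)%N).
Implicit Types I : 'I_k -> finType.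

Lemma flattening_asymptotic_rank_le I (T : tensor F I) i0 (E : finType)
    (A : E -> I i0 -> F) (B : {dffun forall i, I i} -> E -> F) :
  (forall e e', \sum_a \sum_y A e a * T (set_leg y a) * B y e' = (e == e')%:R) ->
  #|E|%:R <= asymptotic_rank R T.
Proof.
move=> AB; rewrite leNgt; apply/negP => TE.
have [Ts sE] := midf_lt TE; set s := (_ / _) in Ts sE.
have [C _ TC] := prank_growth hk Ts.
suff : #|E|%:R <= s by rewrite leNgt sE.
apply: (@le_expr_growth _ _ _ C) => [|N _].
  by rewrite (le_trans _ (ltW Ts)) // asymptotic_rank_ge0.
by rewrite -natrX (le_trans _ (TC N)) // ler_nat (flattening_pow_le hk _ AB).
Qed.

Lemma leg_projection I (T : tensor F I) i0 (B : nat) :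
  asymptotic_rank R T < B%:R ->
  exists U : I i0 -> 'I_B -> F, exists V : 'I_B -> I i0 -> F, forall y a,
    \sum_a' (\sum_b U a b * V b a') * T (set_leg y a') = T (set_leg y a).
Proof.
move=> TB; pose D : finType := {dffun forall i, I i}.
pose M := \matrix_(a < #|I i0|, y < #|D|)
  T (set_leg (enum_val y : {dffun forall i, I i}) (enum_val a)).
pose r := \rank M.
have ME y a : M (enum_rank a) (enum_rank y) = T (set_leg y a).
  by rewrite mxE !enum_rankK.
have rB : (r <= B)%N.
  have [L LM] := row_fullP (col_base_full M).
  have [Q QM] := row_freeP (row_base_free M).
  rewrite -(ler_nat R) -[r]card_ord (le_trans _ (ltW TB)) //.
  apply: (@flattening_asymptotic_rank_le _ _ i0 _
    (fun e a => L e (enum_rank a)) (fun y e => Q (enum_rank y) e)) => e e'.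
  have : (L *m M *m Q) e e' = (e == e')%:R.
    transitivity ((L *m (col_base M *m row_base M) *m Q) e e').
      by rewrite mulmx_base.
    by rewrite mulmxA LM mul1mx QM mxE.
  move=> <-; rewrite mxE.
  rewrite [RHS](reindex (@enum_rank D)) /=; last exact/onW_bij/enum_rank_bij.
  rewrite exchange_big; apply: eq_bigr => y _; rewrite mxE mulr_suml.
  rewrite [RHS](reindex (@enum_rank (I i0))) /=; last exact/onW_bij/enum_rank_bij.
  by apply: eq_bigr => a _; rewrite ME.
pose U : 'M[F]_(#|I i0|, B) := col_base M *m pid_mx r.
pose V : 'M[F]_(B, #|I i0|) := pid_mx r *m (row_base M *m pinvmx M).
have UVM : U *m V *m M = M.
  have -> : U *m V = col_base M *m row_base M *m pinvmx M.
    transitivity (col_base M *m ((pid_mx r : 'M[F]_(r, B)) *m (pid_mx r : 'M[F]_(B, r))) *m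
                  (row_base M *m pinvmx M)).
      by rewrite /U /V !mulmxA.
    by rewrite mul_pid_mx minnn (minn_idPr rB) pid_mx_1 mulmx1 mulmxA.
  by rewrite mulmx_base mulmxKpV.
exists (fun a b => U (enum_rank a) b), (fun b a => V b (enum_rank a)) => y a.
rewrite -ME -[in RHS]UVM mxE.
rewrite [RHS](reindex (@enum_rank (I i0))) /=; last exact/onW_bij/enum_rank_bij.
by apply: eq_bigr => a' _; rewrite ME mxE.
Qed.

Lemma compress I (T : tensor F I) (B : nat) : asymptotic_rank R T < B%:R ->
  exists S : tensor F (fun _ : 'I_k => 'I_B : finType),
    asymptotic_rank R S = asymptotic_rank R T.
Proof.
move=> TB.
pose h i0 := cid (leg_projection i0 TB).
pose U i0 := projT1 (h i0); pose h' i0 := cid (projT2 (h i0)).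
pose V i0 := projT1 (h' i0); have UV i0 := projT2 (h' i0).
exists (legwise V T); apply: eq_asymptotic_rank => n; apply/eqP.
rewrite eqn_leq prank_legwise //=.
rewrite -{1}(legwise_all_legs (fun i0 y a => UV i0 y a)).
by rewrite -legwise_comp prank_legwise.
Qed.

End CompressionRank.

(** * Polynomial conditions on powers *)

Section Span.
Variable F : fieldType.

Lemma finite_spanning_rows N (Q : set 'rV[F]_N) :
  exists m (A : 'M[F]_(m, N)),
    [/\ (m <= N)%N, forall i, Q (row i A) & forall v, Q v -> (v <= A)%MS].
Proof.
pose good m := `[< exists2 A : 'M[F]_(m, N), row_free A & forall i, Q (row i A) >].
have good0 : exists m, good m.
  by exists 0%N; apply/asboolP; exists 0; [rewrite /row_free mxrank0 | case].
have good_le m : good m -> (m <= N)%N.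
  by move=> /asboolP[A /eqP + _]; have := rank_leq_col A; move=> /[swap] ->.
case: (ex_maxnP good0 good_le) => m /asboolP[A Afree AQ] mmax.
exists m, A; split=> // [|v Qv].
  by apply: good_le; apply/asboolP; exists A.
apply: contraT => vA; suff : good (1 + m)%N by move/mmax; rewrite ltnn.
apply/asboolP; exists (col_mx v A : 'M[F]_(1 + m, N)); last first.
  move=> i; rewrite -(@fintype.splitK 1 m i); case: fintype.split => j /=.
    by rewrite rowKu ord1 row_id.
  by rewrite rowKd.
rewrite /row_free eqn_leq rank_leq_row /= -addsmxE.
rewrite ltnNge; apply: contra vA => h.
have : (A == v + A)%MS.
  rewrite -(geq_leqif (mxrank_leqif_eq (addsmxSr v A))).
  by move: Afree => /eqP ->.
by move=> /eqmxP ->; apply: addsmxSl.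
Qed.

Variable D : finType.

Definition poly_at (T : {ffun D -> F}) : mpoly.mpoly #|D| F -> F :=
  mpoly.meval (fun i => T (enum_val i)).

Lemma poly_at0 T : poly_at T 0 = 0. Proof. exact: rmorph0. Qed.

Lemma poly_at1 T : poly_at T 1 = 1. Proof. exact: rmorph1. Qed.

Lemma poly_atD T p q : poly_at T (p + q) = poly_at T p + poly_at T q.
Proof. exact: rmorphD. Qed.

Lemma poly_atM T p q : poly_at T (p * q) = poly_at T p * poly_at T q.
Proof. exact: rmorphM. Qed.

Definition monom n (T : {ffun D -> F}) (m : {ffun D -> 'I_n.+1}) : F :=
  \prod_y T y ^+ m y.

Definition mpoly_monom n (m : {ffun D -> 'I_n.+1}) : mpoly.mpoly #|D| F :=
  \prod_y mpoly.mpolyX F (mpoly.mnm1 (enum_rank y)) ^+ m y.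

Lemma poly_at_monom n (T : {ffun D -> F}) (m : {ffun D -> 'I_n.+1}) :
  poly_at T (mpoly_monom m) = monom T m.
Proof.
rewrite /poly_at /mpoly_monom rmorph_prod; apply: eq_bigr => y _.
by rewrite rmorphXn /= mpoly.mevalXU enum_rankK.
Qed.

Lemma span_monom (X : set {ffun D -> F}) n :
  exists m (S : 'I_m -> {ffun D -> F})
    (P : 'I_#|{ffun D -> 'I_n.+1}| -> mpoly.mpoly #|D| F),
  [/\ (m <= n.+1 ^ #|D|)%N, forall i, X (S i),
      forall T, X T -> forall l, poly_at T (P l) = 0 &
      forall T, (forall l, poly_at T (P l) = 0) ->
        exists c : 'I_m -> F, forall t : {ffun D -> 'I_n.+1},
          monom T t = \sum_i c i * monom (S i) t].
Proof.
pose M : finType := {ffun D -> 'I_n.+1}.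
pose mrow (T : {ffun D -> F}) : 'rV[F]_#|M| := \row_j monom T (enum_val j : M).
have [m [A [mM AX XA]]] := finite_spanning_rows [set mrow T | T in X].
have /boolp.choice[S AS] : forall i, exists T, X T /\ mrow T = row i A.
  by move=> i; have [T XT e] := AX i; exists T.
pose P (l : 'I_#|M|) : mpoly.mpoly #|D| F :=
  \sum_j cokermx A j l *: mpoly_monom (enum_val j : M).
have PE T l : poly_at T (P l) = (mrow T *m cokermx A) ord0 l.
  rewrite /poly_at raddf_sum mxE; apply: eq_bigr => j _ /=.
  rewrite mpoly.mevalZ [mrow _ _ _]mxE mulrC; congr (_ * _).
  exact: poly_at_monom.
exists m, S, P; split=> [|i|T XT l|T PT].
- by rewrite (leq_trans mM) // card_ffun card_ord.
- by have [] := AS i.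
- have : (mrow T <= A)%MS by apply: XA; exists T.
  by rewrite PE submxE => /eqP ->; rewrite mxE.
have : (mrow T <= A)%MS.
  by rewrite submxE; apply/eqP/rowP => l; rewrite -PE PT mxE.
move=> /submxP[c Tc]; exists (fun i => c ord0 i) => t.
transitivity (mrow T ord0 (enum_rank t)); first by rewrite mxE enum_rankK.
rewrite Tc mxE; apply: eq_bigr => i _; congr (_ * _).
by have [_ /rowP/(_ (enum_rank t))] := AS i; rewrite !mxE enum_rankK.
Qed.

End Span.

Section AsymptoticRankSpan.
Variables (R : realType) (F : fieldType) (k : nat) (hk : (0 < k)%N).
Variable I : 'I_k -> finType.
Let D : finType := {dffun forall i, I i}.

Lemma family_prod_monom n (T : tensor F I) (f : {dffun forall i, {ffun 'I_n -> I i}}) :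
  family_prod (fun _ : 'I_n => T) f =
  monom T [ffun y : D =>
    inord #|[pred t | (finfun (fun i => f i t) : D) == y]| : 'I_n.+1].
Proof.
rewrite ffunE (partition_big (fun t => finfun (fun i => f i t) : D) xpredT) //=.
apply: eq_bigr => y _; rewrite ffunE inordK; last first.
  by rewrite ltnS -[leqRHS]card_ord max_card.
rewrite (eq_bigr (fun=> T y)) => [|t /eqP <-//].
by rewrite prodr_const.
Qed.

(* The span of the powers [S^n] lies in a space of dimension [(n+1)^#|D|]
   since [S^n] has that many distinct coordinate functions, so [T^n] is a
   combination of polynomially many of them. *)
Lemma asymptotic_rank_span n (s : R) : (0 < n)%N -> 0 < s ->
  exists P : 'I_#|{ffun D -> 'I_n.+1}| -> mpoly.mpoly #|D| F,
    (forall T : tensor F I, asymptotic_rank R T < s ->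
       forall l, poly_at T (P l) = 0) /\
    (forall T : tensor F I, (forall l, poly_at T (P l) = 0) ->
       asymptotic_rank R T ^+ n <= n.+1%:R ^+ #|D| * s ^+ n).
Proof.
move=> n0 s0.
have [m [S [P [mn Ss PX PT]]]] :=
  @span_monom F D [set T : tensor F I | asymptotic_rank R T < s] n.
exists P; split=> // T /PT[c Tc].
apply: le_trans (_ : #|'I_m|%:R * s ^+ n <= _).
  apply: (asymptotic_rank_comb hk (c := c) (S := S)) => // f.
  rewrite family_prod_monom Tc; apply: eq_bigr => i _.
  by rewrite family_prod_monom.
by rewrite card_ord ler_wpM2r ?exprn_ge0 ?(ltW s0) // -natrX ler_nat.
Qed.

End AsymptoticRankSpan.

(** * Generic points over uncountable fields *)

Section MaximalIdeal.
Variable A : comNzRingType.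

Definition ring_ideal (M : set A) :=
  [/\ M 0, forall x y, M x -> M y -> M (x + y) & forall a x, M x -> M (a * x)].

Lemma maximal_disjoint_ideal (P S : set A) :
  ring_ideal P -> (forall x, S x -> ~ P x) ->
  exists M, [/\ ring_ideal M, P `<=` M, forall x, S x -> ~ M x &
    forall x, ~ M x -> exists s a, S s /\ M (s - a * x)].
Proof.
move=> idP SP.
pose good (M : set A) :=
  M = set0 \/ [/\ ring_ideal M, P `<=` M & forall x, S x -> ~ M x].
have [] := @Zorn_bigcup A good.
  move=> H Hgood Htot.
  have [[M0 HM0 M0n0]|Hn] := pselect (exists2 M, H M & M !=set0); last first.
    left; apply/seteqP; split=> // x [M HM Mx]; apply: Hn.
    by exists M => //; exists x.
  have Hg M : H M -> M !=set0 ->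
      [/\ ring_ideal M, P `<=` M & forall x, S x -> ~ M x].
    by move=> /Hgood[->|//] [].
  right; split.
  - split.
    + by exists M0 => //; have [[]] := Hg _ HM0 M0n0.
    + move=> x y [M HM Mx] [M' HM' My].
      have [MM'|MM'] := Htot _ _ HM HM'.
        exists M' => //; have [[_ + _] _ _] := Hg _ HM' (ex_intro _ y My).
        by apply=> //; apply: MM'.
      exists M => //; have [[_ + _] _ _] := Hg _ HM (ex_intro _ x Mx).
      by apply=> //; apply: MM'.
    + move=> a x [M HM Mx]; exists M => //.
      by have [[_ _ +] _ _] := Hg _ HM (ex_intro _ x Mx); apply.
  - by move=> x Px; exists M0 => //; have [_ + _] := Hg _ HM0 M0n0; apply.
  - move=> x Sx [M HM Mx].
    by have [_ _ /(_ x Sx)] := Hg _ HM (ex_intro _ x Mx).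
move=> M [[M0|[idM PM SM]] Mmax].
  case: (Mmax P); last by right; split.
  rewrite M0; split=> // h; have [P0 _ _] := idP.
  exact: (h _ P0).
exists M; split=> // x nMx; apply: contrapT => nS.
have [M0 MD MM] := idM.
pose M' : set A := [set y | exists2 m, M m & exists a, y = m + a * x].
apply: (Mmax M').
  split=> [m Mm|h]; first by exists m => //; exists 0; rewrite mul0r addr0.
  by apply/nMx/h; exists 0 => //; exists 1; rewrite add0r mul1r.
right; split.
- split.
  + by exists 0 => //; exists 0; rewrite mul0r addr0.
  + move=> _ _ [m Mm [a ->]] [m' Mm' [a' ->]]; exists (m + m'); first exact: MD.
    by exists (a + a'); rewrite mulrDl addrACA.
  + move=> b _ [m Mm [a ->]]; exists (b * m); first exact: MM.
    by exists (b * a); rewrite mulrDr mulrA.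
- by move=> y /PM My; exists y => //; exists 0; rewrite mul0r addr0.
- move=> s Ss [m Mm [a sE]]; apply: nS; exists s, a; split=> //.
  by rewrite sE addrK.
Qed.

End MaximalIdeal.

Lemma uncountable_fiber (T : Type) (U : countType) (h : T -> U) :
  ~ countable [set: T] -> exists u, infinite_set (h @^-1` [set u]).
Proof.
move=> nT; apply: contrapT => nu; apply: nT.
have -> : [set: T] = \bigcup_(u in [set: U]) (h @^-1` [set u]).
  by apply/seteqP; split=> // x _; exists (h x).
apply: bigcup_countable => // u _; apply: finite_set_countable.
by apply: contrapT => inf; apply: nu; exists u.
Qed.

Section Points.
Variables (F : closedFieldType) (n : nat).
Hypothesis F_uncountable : ~ countable [set: F].
Local Notation A := (mpoly.mpoly n F).

(* Otherwise every scalar [c] yields [s_c = g_c * (x - c)] modulo [M] with [s_c]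
   in [S].  As [S] is countable and [F] is not, infinitely many [c] share [s_c]
   and the support of [g_c]; a linear relation between these [g_c] puts
   [s * q(x)] in [M] for some univariate [q != 0], which splits over [F]. *)
Lemma residue_scalar (M S : set A) (x : A) :
  ring_ideal M -> (forall s, S s -> ~ M s) ->
  (forall s t, S s -> S t -> S (s * t)) ->
  (exists e : seq nat -> A, S = range e) ->
  (forall y, ~ M y -> exists s a, S s /\ M (s - a * y)) ->
  exists c : F, M (x - c%:A).
Proof.
move=> [M0 MD MM] SM SS [e Se] Mmax; apply: contrapT => nx.
have MB y z : M y -> M z -> M (y - z).
  by move=> My Mz; rewrite -mulN1r; apply: MD => //; apply: MM.
have MZ (c : F) y : M y -> M (c *: y) by rewrite -mulr_algl; apply: MM.
have /boolp.choice[g gM] : forall c : F, exists lg : seq nat * A,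
    M (e lg.1 - lg.2 * (x - c%:A)).
  move=> c; have [s [a [+ Msa]]] : exists s a, S s /\ M (s - a * (x - c%:A)).
    by apply: Mmax => Mx; apply: nx; exists c.
  by rewrite Se => -[l _ le]; exists (l, a) => /=; rewrite le.
have Se' l : S (e l) by rewrite Se; exists l.
have no_split l (r : seq F) : ~ M (e l * \prod_(z <- r) (x - z%:A)).
  have : S (e l) by [].
  elim: r (e l) => [|z r IH] s Ss; first by rewrite big_nil mulr1; apply: SM.
  rewrite big_cons => Mr; apply: (IH (s * e (g z).1)); first exact: SS.
  have := MM (s * \prod_(z <- r) (x - z%:A)) _ (gM z).
  have := MM (g z).2 _ Mr; move=> /MD/[apply].
  by congr (M _); ring.
have [[l sigma] infl] := @uncountable_fiber F
  (seq nat * seq (mpoly.multinom n))%type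
  (fun c => ((g c).1, mpoly.msupp (g c).2 : seq _)) F_uncountable.
pose d := size sigma.
have [B BX Bd] := infinite_set_fset d.+1 infl.
pose a (j : 'I_d.+1) : F := nth 0 (finmap.enum_fset B) j.
have aX j : (g (a j)).1 = l /\ mpoly.msupp (g (a j)).2 = sigma :> seq _.
  have aB : a j \in finmap.enum_fset B by apply: mem_nth; apply: leq_trans Bd.
  by have [-> ->] := BX (a j) aB.
have a_inj : injective a.
  move=> i j /eqP; rewrite nth_uniq ?finmap.fset_uniq //; try exact: leq_trans Bd.
  by move=> /eqP/val_inj.
pose G : 'M[F]_(d.+1, d) :=
  \matrix_(j, i) mpoly.mcoeff (tnth (in_tuple sigma) i) (g (a j)).2.
have : kermx G != 0.
  rewrite -mxrank_eq0 mxrank_ker -lt0n subn_gt0.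
  by rewrite (leq_ltn_trans (rank_leq_col G)).
move=> /rowV0Pn[u /sub_kermxP uG u0].
have gsum : \sum_j u ord0 j *: (g (a j)).2 = 0.
  transitivity (\sum_j u ord0 j *: \sum_i G j i *:
      mpoly.mpolyX F (tnth (in_tuple sigma) i)).
    apply: eq_bigr => j _; congr (_ *: _).
    rewrite [LHS]mpoly.mpolyE (aX j).2 big_tnth.
    by apply: eq_bigr => i _; rewrite mxE.
  under eq_bigr do rewrite scaler_sumr.
  rewrite exchange_big big1 //= => i _.
  under eq_bigr do rewrite scalerA.
  rewrite -scaler_suml; have /rowP/(_ i) := uG; rewrite !mxE => ->.
  by rewrite scale0r.
pose W j : {poly F} := \prod_(i | i != j) ('X - (a i)%:P).
pose q : {poly F} := \sum_j u ord0 j *: W j.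
have q0 : q != 0.
  have [j uj] : exists j, u ord0 j != 0.
    apply/existsP; apply: contraNT u0; rewrite negb_exists => /forallP h.
    by apply/eqP/rowP => j; apply/eqP; rewrite !mxE -[_ == _]negbK h.
  apply: contraNneq uj => /(congr1 (fun p => p.[a j])).
  rewrite horner0 horner_sum (bigD1 j) //= big1 ?addr0 => [|i ij].
    rewrite hornerZ => /eqP; rewrite mulf_eq0 => /orP[//|].
    rewrite horner_prod prodf_seq_eq0 => /hasP[i _ /andP[ij]].
    by rewrite hornerXsubC subr_eq0 (inj_eq a_inj) eq_sym (negbTE ij).
  rewrite hornerZ horner_prod (bigD1 j) 1?eq_sym //= hornerXsubC subrr.
  by rewrite mul0r mulr0.
have Mq : M (e l * horner_alg x q).
  have hW j : horner_alg x (W j) = \prod_(i | i != j) (x - (a i)%:A).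
    rewrite rmorph_prod; apply: eq_bigr => i _.
    by rewrite rmorphB /= horner_algX horner_algC.
  pose V := \prod_i (x - (a i)%:A).
  have -> : e l * horner_alg x q =
      \sum_j u ord0 j *: ((e l - (g (a j)).2 * (x - (a j)%:A)) * horner_alg x (W j)).
    transitivity (\sum_j (u ord0 j *: (e l * horner_alg x (W j)) -
        u ord0 j *: (g (a j)).2 * V)).
      rewrite sumrB -mulr_suml gsum mul0r subr0 raddf_sum mulr_sumr.
      by apply: eq_bigr => j _; rewrite /= linearZ /= mulr_algl scalerAr.
    apply: eq_bigr => j _; rewrite mulrBl scalerBr; congr (_ - _).
    by rewrite -scalerAl /V (bigD1 j) //= hW mulrA.
  apply: big_ind => // j _; apply: MZ; rewrite mulrC; apply: MM.
  by rewrite -(aX j).1.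
have [r qr] := closed_field_poly_normal q.
apply: (@no_split l r).
suff -> : \prod_(z <- r) (x - z%:A) = (lead_coef q)^-1 *: horner_alg x q.
  by rewrite -scalerAr; apply: MZ.
rewrite [in horner_alg _ _]qr linearZ /= mulr_algl scalerA mulVf ?lead_coef_eq0 // scale1r.
rewrite rmorph_prod; apply: eq_bigr => z _.
by rewrite rmorphB /= horner_algX horner_algC.
Qed.

(* An uncountable-field Nullstellensatz with countably many inequations. *)
Lemma exists_generic_point (P : set A) (f : nat -> A) :
  ring_ideal P -> (forall l : seq nat, ~ P (\prod_(i <- l) f i)) ->
  exists v : 'I_n -> F,
    (forall p, P p -> mpoly.meval v p = 0) /\
    (forall i, mpoly.meval v (f i) != 0).
Proof.
move=> idP fP.
pose e (l : seq nat) : A := \prod_(i <- l) f i.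
have [|M [idM PM SM Mmax]] := @maximal_disjoint_ideal _ P (range e) idP.
  by move=> _ [l _ <-]; apply: fP.
have sc (x : A) : exists c : F, M (x - c%:A).
  apply: (@residue_scalar M (range e) x idM SM) => //; last by exists e.
  by move=> _ _ [l _ <-] [l' _ <-]; exists (l ++ l') => //; rewrite /e big_cat.
have /boolp.choice[v Mv] := fun i => sc (mpoly.mpolyX F (mpoly.mnm1 i)).
have [M0 MD MM] := idM.
have MZ (c : F) y : M y -> M (c *: y) by rewrite -mulr_algl; apply: MM.
pose Q p := M (p - (mpoly.meval v p)%:A).
have QD p q : Q p -> Q q -> Q (p + q).
  by move=> Qp Qq; rewrite /Q rmorphD scalerDl opprD addrACA; apply: MD.
have QM p q : Q p -> Q q -> Q (p * q).
  move=> Qp Qq; rewrite /Q rmorphM /=.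
  have -> : (mpoly.meval v p * mpoly.meval v q)%:A =
      (mpoly.meval v p)%:A * (mpoly.meval v q)%:A :> A.
    by rewrite mulr_algl scalerA.
  have := MD _ _ (MM q _ Qp) (MM (mpoly.meval v p)%:A _ Qq).
  by rewrite !mulrBr addrA [q * p]mulrC [q * _%:A]mulrC subrK.
have Q1 : Q 1 by rewrite /Q rmorph1 scale1r subrr.
have QZ c p : Q p -> Q (c *: p).
  by move=> Qp; rewrite /Q mpoly.mevalZ -scalerA -scalerBr; apply: MZ.
have Qall p : Q p.
  rewrite [p]mpoly.mpolyE; apply: (big_ind Q) => [||m _] //.
    by rewrite /Q rmorph0 scale0r subrr.
  apply: QZ; rewrite mpoly.mpolyXE_id; apply: (big_ind Q) => // i _.
  elim: (m i) => [|t IH]; first by rewrite expr0.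
  by rewrite exprS; apply: QM => //; rewrite /Q mpoly.mevalXU; apply: Mv.
have M1 (c : F) : M c%:A -> c = 0.
  move=> Mc; apply: contrapT => /eqP c0.
  apply: (SM 1); first by exists [::] => //; rewrite /e big_nil.
  by rewrite -(scale1r 1) -(mulVf c0) -scalerA; apply: MZ.
exists v; split=> [p /PM Mp|i].
  apply: M1; rewrite -[_%:A](subKr p); rewrite opprB addrC.
  by have := MD _ _ Mp (MM (-1) _ (Qall p)); rewrite mulN1r opprB addrC.
apply/eqP => fi; apply: (SM (f i)).
  by exists [:: i] => //; rewrite /e big_seq1.
by have := Qall (f i); rewrite /Q fi scale0r subr0.
Qed.

End Points.

(** * Limits of asymptotic ranks *)

Lemma real_uncountable (R : realType) : ~ countable [set: R].
Proof.
move=> cR; have c01 : countable `[0 : R, 1]%classic.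
  by apply: sub_countable cR; apply: subset_card_le.
have := countable_lebesgue_measure0 c01.
rewrite lebesgue_measure_itv /= lte_fin ltr01 -EFinB subr0 => /eqP.
by rewrite eqe oner_eq0.
Qed.

Lemma complex_uncountable (R : realType) : ~ countable [set: R[i]].
Proof.
move=> cC; apply: (@real_uncountable R).
have -> : [set: R] = (@complex.Re R) @` [set: R[i]].
  by apply/seteqP; split=> // x _; exists (x%:C)%C.
by apply: sub_countable cC; apply: card_image_le.
Qed.

Lemma le_of_poly_growth (R : realType) (D : nat) (x s : R) : 0 < s ->
  (forall n, (0 < n)%N -> x ^+ n <= n.+1%:R ^+ D * s ^+ n) -> x <= s.
Proof.
move=> s0 xs; rewrite leNgt; apply/negP => sx.
have q1 : 1 < x / s by rewrite ltr_pdivlMr // mul1r.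
near \oo => n.
have n0 : (0 < n)%N by near: n; exists 1%N.
have : 2 * n.+1%:R ^+ D <= (x / s) ^+ n.
  by near: n; apply: near_poly_le_expr.
rewrite expr_div_n ler_pdivlMr ?exprn_gt0 // => /le_trans/(_ (xs n n0)).
rewrite ler_pM2r ?exprn_gt0 // leNgt => /negP; apply.
by rewrite ltr_pMl ?exprn_gt0 // ltr1n.
Unshelve. all: by end_near. Qed.

Section LimitPoint.
Variables (R : realType) (k : nat) (hk : (0 < k)%N) (I : 'I_k -> finType).
Let D : finType := {dffun forall i, I i}.
Local Notation V := (tensor R[i] I).
Local Notation arank := (@asymptotic_rank R _ k I).
Variables (r : R) (U : set_system V).
Hypothesis U_ultra : UltraFilter U.
Hypothesis U_cvg : forall e, 0 < e -> U [set T | `|arank T - r| < e].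

Let P : set (mpoly.mpoly #|D| R[i]) := [set p | U [set T | poly_at T p = 0]].

Let P_ideal : ring_ideal P.
Proof.
split.
- by rewrite /P /=; apply: filterS filterT => T _; rewrite /= poly_at0.
- move=> p q Pp Pq; apply: filterS (filterI Pp Pq) => T /= [].
  by rewrite poly_atD => -> ->; rewrite addr0.
- move=> a p; apply: filterS => T /=; rewrite poly_atM => ->.
  by rewrite mulr0.
Qed.

Let P1 : ~ P 1.
Proof.
move=> /filter_ex[T] /=; rewrite poly_at1 => /eqP.
by rewrite oner_eq0.
Qed.

Let P_prime p q : P (p * q) -> P p \/ P q.
Proof.
move=> Ppq; have [|np] := in_ultra_setVsetC [set T : V | poly_at T p = 0] U_ultra.
  by left.
right; apply: filterS (filterI Ppq np) => T /= [].
by rewrite poly_atM => /eqP; rewrite mulf_eq0 => /orP[/eqP//|/eqP].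
Qed.

(* If every polynomial vanishing on [arank < s] vanished [U]-almost everywhere,
   then [U]-almost every [T] would have [arank T ^ n] at most
   [(n+1) ^ #|D| * s ^ n], which is too small since [arank] tends to [r > s]. *)
Lemma vanishing_poly s : s < r ->
  exists f, ~ P f /\ forall T : V, arank T < s -> poly_at T f = 0.
Proof.
move=> sr; have [s0|s0] := leP s 0.
  exists 1; split=> // T Ts; have := asymptotic_rank_ge0 R hk T.
  by rewrite leNgt (lt_le_trans Ts).
apply: contrapT => nf.
have fP f : (forall T : V, arank T < s -> poly_at T f = 0) -> P f.
  by move=> fX; apply: contrapT => nPf; apply: nf; exists f.
have [ss' s'r] := midf_lt sr; set s' := (_ / _) in ss' s'r.
suff : s' <= s by rewrite leNgt ss'.
apply: (@le_of_poly_growth _ #|D|) => // n n0.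
have [Q [QX QV]] := @asymptotic_rank_span R R[i] k hk I n s n0 s0.
have QU : U [set T | forall l, poly_at T (Q l) = 0].
  by apply: filter_forall => l; apply: fP => T Ts; apply: QX.
have rs' : 0 < r - s' by rewrite subr_gt0.
have [T [/QV QT Tr]] := filter_ex (filterI QU (U_cvg rs')).
apply: le_trans QT; apply: lerXn2r; rewrite ?nnegrE ?asymptotic_rank_ge0 //.
  by rewrite (le_trans (ltW s0) (ltW ss')).
move: Tr; rewrite /= distrC ltr_distlC => /andP[+ _]; rewrite opprB.
by rewrite addrC subrK => /ltW.
Qed.

Lemma exists_tensor_limit_rank : exists T : V, arank T = r.
Proof.
have /boolp.choice[f fP] : forall m : nat, exists f, ~ P f /\
    forall T : V, arank T < r - m.+1%:R^-1 -> poly_at T f = 0.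
  by move=> m; apply: vanishing_poly; rewrite ltrBlDr ltrDl invr_gt0.
have fprod (l : seq nat) : ~ P (\prod_(i <- l) f i).
  elim: l => [|i l IH]; first by rewrite big_nil.
  by rewrite big_cons => /P_prime[|//]; have [] := fP i.
have [v [vP vf]] := exists_generic_point (@complex_uncountable R) P_ideal fprod.
pose T : V := [ffun y => v (enum_rank y)].
have TE p : poly_at T p = mpoly.meval v p.
  by apply: mpoly.meval_eq => i; rewrite ffunE enum_valK.
exists T; apply/eqP; rewrite eq_le; apply/andP; split.
  apply/ler_addgt0Pr => e e0; set s := r + e.
  have Us : U [set T : V | arank T < s].
    apply: filterS (U_cvg e0) => S /=.
    by rewrite ltr_distl => /andP[].
  have s0 : 0 < s.
    have [S Ss] := filter_ex Us.
    by apply: le_lt_trans Ss; apply: asymptotic_rank_ge0.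
  apply: (@le_of_poly_growth _ #|D|) => // n n0.
  have [Q [QX QV]] := @asymptotic_rank_span R R[i] k hk I n s n0 s0.
  apply: QV => l; rewrite TE; apply: vP.
  by apply: filterS Us => S Ss; apply: QX.
rewrite leNgt; apply/negP => Tr.
have rT0 : 0 < r - arank T by rewrite subr_gt0.
near \oo => m.
have : poly_at T (f m) = 0.
  apply: (fP m).2; rewrite ltrBrDl -ltrBrDr.
  by near: m; apply: near_infty_natSinv_lt (PosNum rT0).
by rewrite TE; apply/eqP; apply: vf.
Unshelve. all: by end_near. Qed.

End LimitPoint.

Theorem theorem4p1 (R : realType) (k : nat) (hk : (0 < k)%N) :
  closed (asymptotic_ranks R k).
Proof.
move=> r rcl.
have [B rB] : exists B : nat, r + 1 < B%:R.
  near \oo => B; exists B; near: B; exact: nbhs_infty_gtr.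
pose I : 'I_k -> finType := fun _ => 'I_B.
have approx e : 0 < e ->
    exists T : tensor R[i] I, `|asymptotic_rank R T - r| < e.
  move=> e0; have m0 : 0 < Num.min e 1 by rewrite lt_min e0 ltr01.
  have [_ [[d [_ [T0 ->]]]]] := rcl _ (nbhsx_ballx r _ m0).
  rewrite /ball /= lt_min => /andP[T0e T01].
  have T0B : asymptotic_rank R T0 < B%:R.
    apply: lt_trans rB; rewrite -ltrBlDl.
    by apply: le_lt_trans T01; rewrite distrC ler_norm.
  have [T TT0] := compress hk T0B.
  by exists T; rewrite TT0 distrC.
pose G : set_system (tensor R[i] I) := filter_from [set e : R | 0 < e]
  (fun e => [set T | `|asymptotic_rank R T - r| < e]).
have G_proper : ProperFilter G.
  apply: filter_from_proper => [|e e0]; last exact: approx.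
  apply: filter_from_filter; first by exists 1 => /=.
  move=> e1 e2 /= e10 e20; exists (Num.min e1 e2); first by rewrite /= lt_min e10.
  by move=> T /=; rewrite lt_min => /andP[].
have [U [U_ultra GU]] := ultraFilterLemma G_proper.
have [|T <-] := @exists_tensor_limit_rank R k hk I r U U_ultra.
  by move=> e e0; apply: GU; exists e.
exists (fun=> B); split; last by exists T.
move=> _; rewrite -(ltr_nat R); apply: le_lt_trans rB.
have [S Sr] := approx 1 ltr01.
have := asymptotic_rank_ge0 R hk S.
by move: Sr; rewrite ltr_distlC => /andP[]; lra.
Unshelve. all: by end_near. Qed.
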